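(* Given an encapsulated TPTL formula $\varphi$ and a finite timed state sequence $\hat{\rho}$, after the execution of the TPTL monitoring algorithm (Algorithm 1) the returned value satisfies $M[1,0]=\top$ if and only if $(\hat{\rho},0,\mathbf{0})\models\varphi$.
   Context: A timed state sequence (TSS) $\rho=(\sigma,\tau)$ pairs a state sequence $\sigma=\sigma_0\sigma_1\cdots$ with $\sigma_i\subseteq AP$ (a finite set of atomic propositions) and a time sequence $\tau=\tau_0\tau_1\cdots$ with $\tau_i\in\mathbb{R}_+$ that is initialized ($\tau_0=0$), monotonic and progressive; $\hat{\rho}=(\hat{\sigma},\hat{\tau})$ denotes a finite prefix with $|\hat{\rho}|$ samples. TPTL formulas (Raskin's semantics) are built from $\top$, atoms $a\in AP$, time constraints $x\sim r$ ($x$ a time variable, $r\in\mathbb{R}_+$, $\sim\in\{\le,<,=,>,\ge\}$), $\neg,\wedge,\vee$, next $\bigcirc$, until $U$, and freeze quantifiers $x.\varphi$. Finite-trace semantics with environment $\varepsilon:V\to\mathbb{R}_+$: $(\hat{\rho},i,\varepsilon)\models a$ iff $a\in\sigma_i$; $(\hat{\rho},i,\varepsilon)\models\bigcirc\varphi$ iff $i<|\hat{\rho}|-1$ and $(\hat{\rho},i+1,\varepsilon)\models\varphi$; $(\hat{\rho},i,\varepsilon)\models\varphi_1U\varphi_2$ iff there is $j$ with $i\le j<|\hat{\rho}|$, $(\hat{\rho},j,\varepsilon)\models\varphi_2$ and $(\hat{\rho},k,\varepsilon)\models\varphi_1$ for all $i\le k<j$; $(\hat{\rho},i,\varepsilon)\models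 x\sim r$ iff $(\tau_i-\varepsilon(x))\sim r$; $(\hat{\rho},i,\varepsilon)\models x.\varphi$ iff $(\hat{\rho},i,\varepsilon[x:=\tau_i])\models\varphi$; Boolean connectives as usual. $\mathbf{0}$ is the environment mapping every variable to $0$. A time variable $x$ is independent if it is in the scope of only one freeze quantifier $x.$ and no other time variable is in the scope of that quantifier; a formula is encapsulated if all its time variables are independent. Algorithm 1 fills a table $M$ whose rows are the subformulas $\varphi_1=\varphi,\varphi_2,\dots$ (indexed in topological order, parents before children) and whose columns are samples $0,\dots,|\hat{\rho}|-1$: it sets atomic-proposition rows from $\hat{\sigma}$; for each time variable $v_k$ (innermost frozen subtree first) and each sample $t$, it evaluates constraint rows $v_k\sim r$ at samples $u\ge t$ as $(\tau_u-\tau_t)\sim r$, evaluates the resulting LTL subformulas of the subtree backwards from $u=|\hat{\rho}|-1$ to $t$ by dynamic programming (Algorithm 2), and copies the subtree root value at $t$ into the row of the freeze node; finally it evaluates the top-level LTL part and returns $M[1,0]$. *)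

(* Defs.v *)
From HB Require Import structures.
From mathcomp Require Import all_boot all_order all_algebra.
From mathcomp Require Import interval_inference reals.

Set Implicit Arguments.
Unset Strict Implicit.
Unset Printing Implicit Defensive.

Import Order.TTheory GRing.Theory Num.Theory.
Local Open Scope ring_scope.

Record tss (R : realType) (AP : finType) := Tss {
  state : nat -> {set AP};
  time : nat -> {nonneg R};
  time_initialized : (time 0)%:num = 0;
  time_monotonic : forall i, (time i)%:num <= (time i.+1)%:num;
  time_progressive : forall T : R, exists i, T < (time i)%:num }.

Definition trace (R : realType) (AP : finType) : Type :=
  seq ({set AP} * {nonneg R}).

Definition prefix_of (R : realType) (AP : finType) (rho : tss R AP) (n : nat) :
    trace R AP :=
  mkseq (fun i => (state rho i, time rho i)) n.

(* Samples are only ever read at indices smaller than the length of the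
   trace, so the default value used here is irrelevant. *)
Definition sample (R : realType) (AP : finType) (h : trace R AP) (i : nat) :
    {set AP} * {nonneg R} :=
  nth (set0, 0%:nng) h i.

Definition state_at (R : realType) (AP : finType) (h : trace R AP) (i : nat) :
  {set AP} := (sample h i).1.

Definition time_at (R : realType) (AP : finType) (h : trace R AP) (i : nat) :
  R := (sample h i).2%:num.

Inductive cmp := CLe | CLt | CEq | CGt | CGe.

Definition cmpb (R : realType) (c : cmp) (a b : R) : bool :=
  match c with
  | CLe => a <= b
  | CLt => a < b
  | CEq => a == b
  | CGt => a > b
  | CGe => a >= b
  end.

Inductive formula (R : realType) (AP : finType) (V : eqType) :=
| Top
| Atom of AP
| Constr of V & cmp & {nonneg R}
| Not of formula R AP V
| And of formula R AP V & formula R AP V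
| Or of formula R AP V & formula R AP V
| Next of formula R AP V
| Until of formula R AP V & formula R AP V
| Freeze of V & formula R AP V.

Arguments Top {R AP V}.
Arguments Atom {R AP V} _.
Arguments Constr {R AP V} _ _ _.

Definition env (R : realType) (V : eqType) : Type := V -> {nonneg R}.

Definition env0 {R : realType} {V : eqType} : env R V := fun=> 0%:nng.

Definition env_set (R : realType) (V : eqType)
    (e : env R V) (x : V) (s : {nonneg R}) : env R V :=
  fun y => if y == x then s else e y.

Fixpoint sat (R : realType) (AP : finType) (V : eqType) (h : trace R AP)
    (i : nat) (e : env R V) (phi : formula R AP V) : Prop :=
  match phi with
  | Top => True
  | Atom a => a \in state_at h i
  | Constr x c r => cmpb c (time_at h i - (e x)%:num) r%:num
  | Not f => ~ sat h i e f
  | And f g => sat h i e f /\ sat h i e g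
  | Or f g => sat h i e f \/ sat h i e g
  | Next f => (i.+1 < size h)%N /\ sat h i.+1 e f
  | Until f g =>
      exists j, [/\ (i <= j < size h)%N, sat h j e g
                  & forall k, (i <= k < j)%N -> sat h k e f]
  | Freeze x f => sat h i (env_set e x (sample h i).2) f
  end.

Definition children (R : realType) (AP : finType) (V : eqType)
    (phi : formula R AP V) : seq (formula R AP V) :=
  match phi with
  | Not f | Next f | Freeze _ f => [:: f]
  | And f g | Or f g | Until f g => [:: f; g]
  | Top | Atom _ | Constr _ _ _ => [::]
  end.

(* A node of the parse tree is the path leading to it from the root: each
   entry is the (0-based) rank of the next child.  [subformula] is only
   meaningful on the paths listed by [nodes]. *)
Definition node : Type := seq nat.

Fixpoint nodes (R : realType) (AP : finType) (V : eqType)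
    (phi : formula R AP V) : seq node :=
  [::] ::
  match phi with
  | Not f | Next f | Freeze _ f => [seq 0%N :: p | p <- nodes f]
  | And f g | Or f g | Until f g =>
      [seq 0%N :: p | p <- nodes f] ++ [seq 1%N :: p | p <- nodes g]
  | Top | Atom _ | Constr _ _ _ => [::]
  end.

Definition subformula (R : realType) (AP : finType) (V : eqType)
    (phi : formula R AP V) (p : node) : formula R AP V :=
  foldl (fun psi i => nth Top (children psi) i) phi p.

(* Variables of the freeze quantifiers, one entry per quantifier. *)
Fixpoint frozen_vars (R : realType) (AP : finType) (V : eqType)
    (phi : formula R AP V) : seq V :=
  match phi with
  | Top | Atom _ | Constr _ _ _ => [::]
  | Not f | Next f => frozen_vars f
  | And f g | Or f g | Until f g => frozen_vars f ++ frozen_vars g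
  | Freeze x f => x :: frozen_vars f
  end.

Fixpoint free_vars (R : realType) (AP : finType) (V : eqType)
    (phi : formula R AP V) : seq V :=
  match phi with
  | Top | Atom _ => [::]
  | Constr x _ _ => [:: x]
  | Not f | Next f => free_vars f
  | And f g | Or f g | Until f g => free_vars f ++ free_vars g
  | Freeze x f => [seq y <- free_vars f | y != x]
  end.

Definition time_vars (R : realType) (AP : finType) (V : eqType)
    (phi : formula R AP V) : seq V :=
  undup (free_vars phi ++ frozen_vars phi).

(* [x] is quantified exactly once, all its occurrences lie in the scope of
   that quantifier, and no other time variable is governed by it: a frozen
   subformula nested in the scope of [x.] is allowed as long as it only
   mentions its own variables, so "in the scope" is read as "free in the
   body". *)
Definition independent (R : realType) (AP : finType) (V : eqType)
    (phi : formula R AP V) (x : V) : Prop :=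
  [/\ count_mem x (frozen_vars phi) = 1%N,
      x \notin free_vars phi
    & forall p psi, p \in nodes phi -> subformula phi p = Freeze x psi ->
        forall y, y \in free_vars psi -> y = x].

Definition encapsulated (R : realType) (AP : finType) (V : eqType)
    (phi : formula R AP V) : Prop :=
  forall x, x \in time_vars phi -> independent phi x.

(* [rows] lists the nodes of the parse tree, parents before children; row j
   of the table (1 <= j <= size rows) is the j-th entry of [rows]. *)
Definition topological (R : realType) (AP : finType) (V : eqType)
    (phi : formula R AP V) (rows : seq node) : Prop :=
  perm_eq rows (nodes phi) /\
  forall p i, rcons p i \in rows -> (index p rows < index (rcons p i) rows)%N.

(* [vs] enumerates the time variables of [phi] so that the variable of an
   inner freeze quantifier precedes those of the quantifiers around it. *)
Definition innermost_first (R : realType) (AP : finType) (V : eqType)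
    (phi : formula R AP V) (vs : seq V) : Prop :=
  perm_eq vs (time_vars phi) /\
  forall p x psi y, p \in nodes phi -> subformula phi p = Freeze x psi ->
    y \in frozen_vars psi -> (index y vs < index x vs)%N.

(* Variable of the innermost freeze quantifier strictly above node [p], or [o]
   if there is none. *)
Fixpoint owner_from (R : realType) (AP : finType) (V : eqType)
    (o : option V) (phi : formula R AP V) (p : node) : option V :=
  if p is i :: q then
    owner_from (if phi is Freeze x _ then Some x else o)
      (nth Top (children phi) i) q
  else o.

Definition row_node (rows : seq node) (j : nat) : node := nth [::] rows j.-1.

Definition row_formula (R : realType) (AP : finType) (V : eqType)
    (phi : formula R AP V) (rows : seq node) (j : nat) : formula R AP V :=
  subformula phi (row_node rows j).

Definition row_child (rows : seq node) (j i : nat) : nat :=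
  (index (rcons (row_node rows j) i) rows).+1.

(* [Some x]: row j lies in the frozen subtree of x, outside the frozen
   subtrees nested in it; [None]: row j is in the top-level LTL part. *)
Definition row_owner (R : realType) (AP : finType) (V : eqType)
    (phi : formula R AP V) (rows : seq node) (j : nat) : option V :=
  owner_from None phi (row_node rows j).

Definition table : Type := nat -> nat -> bool.

Definition set_entry (M : table) (j u : nat) (b : bool) : table :=
  fun j' u' => if (j' == j) && (u' == u) then b else M j' u'.

Definition for_each (A : Type) (s : seq A) (body : A -> table -> table)
    (M : table) : table :=
  foldl (fun M' a => body a M') M s.

(* Atomic, constraint and freeze rows are leaves for the LTL evaluation: their
   entries have already been computed. *)
Definition compute_ltl (R : realType) (AP : finType) (V : eqType)
    (phi : formula R AP V) (rows : seq node) (h : trace R AP)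
    (j u : nat) (M : table) : bool :=
  let m := row_child rows j 0 in
  let n := row_child rows j 1 in
  match row_formula phi rows j with
  | Top => true
  | Atom _ | Constr _ _ _ | Freeze _ _ => M j u
  | Not _ => ~~ M m u
  | And _ _ => M m u && M n u
  | Or _ _ => M m u || M n u
  | Next _ => if u.+1 == size h then false else M m u.+1
  | Until _ _ =>
      if u.+1 == size h then M n u else M n u || (M m u && M j u.+1)
  end.

(* Backward evaluation, from the last sample down to t, of the rows owned by
   [o]; at each sample children are evaluated before their parents. *)
Definition evaluate_ltl (R : realType) (AP : finType) (V : eqType)
    (phi : formula R AP V) (rows : seq node) (h : trace R AP)
    (o : option V) (t : nat) : table -> table :=
  for_each (rev (iota t (size h - t))) (fun u =>
    for_each [seq j <- rev (iota 1 (size rows)) | row_owner phi rows j == o]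
      (fun j M => set_entry M j u (compute_ltl phi rows h j u M))).

Definition set_atoms (R : realType) (AP : finType) (V : eqType)
    (phi : formula R AP V) (rows : seq node) (h : trace R AP) :
    table -> table :=
  for_each (iota 1 (size rows)) (fun j =>
    for_each (iota 0 (size h)) (fun u M =>
      if row_formula phi rows j is Atom a
      then set_entry M j u (a \in state_at h u) else M)).

Definition set_constraints (R : realType) (AP : finType) (V : eqType)
    (phi : formula R AP V) (rows : seq node) (h : trace R AP)
    (v : V) (t : nat) : table -> table :=
  for_each (iota 1 (size rows)) (fun j =>
    for_each (iota t (size h - t)) (fun u M =>
      if row_formula phi rows j is Constr x c r then
        if x == v
        then set_entry M j u (cmpb c (time_at h u - time_at h t) r%:num)
        else M
      else M)).

Definition copy_root (R : realType) (AP : finType) (V : eqType)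
    (phi : formula R AP V) (rows : seq node) (v : V) (t : nat) :
    table -> table :=
  for_each (iota 1 (size rows)) (fun j M =>
    if row_formula phi rows j is Freeze x _ then
      if x == v then set_entry M j t (M (row_child rows j 0) t) else M
    else M).

(* [M0] is the content of the table before the execution. *)
Definition final_table (R : realType) (AP : finType) (V : eqType)
    (phi : formula R AP V) (rows : seq node) (vs : seq V) (h : trace R AP)
    (M0 : table) : table :=
  let M1 := set_atoms phi rows h M0 in
  let M2 :=
    for_each vs (fun v =>
      for_each (iota 0 (size h)) (fun t M =>
        copy_root phi rows v t
          (evaluate_ltl phi rows h (Some v) t
            (set_constraints phi rows h v t M)))) M1 in
  evaluate_ltl phi rows h None 0 M2.

Definition tptl_monitor (R : realType) (AP : finType) (V : eqType)
    (phi : formula R AP V) (rows : seq node) (vs : seq V) (h : trace R AP)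
    (M0 : table) : bool :=
  final_table phi rows vs h M0 1%N 0%N.

(* Main.v *)
Require Import Defs.
From HB Require Import structures.
From mathcomp Require Import all_boot all_order all_algebra.
From mathcomp Require Import interval_inference reals.

Set Implicit Arguments.
Unset Strict Implicit.
Unset Printing Implicit Defensive.

(* In an encapsulated formula every time constraint on x is governed by x., the
   innermost freeze quantifier above it, and every subformula x.psi is closed.
   Hence, once x is anchored at sample t, the rows owned by x are to be
   evaluated in the single environment sending x to tau_t, and the row of x.psi
   does not depend on the environment: its entries, once copied, stay valid for
   all later passes.  Treating inner quantifiers first makes the leaves of each
   pass available, and the pass itself is the usual backward unfolding of
   until. *)

(** * Loops *)

Lemma for_each_inv (A : eqType) (P : table -> Prop) (s : seq A)
    (body : A -> table -> table) (M : table) :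
  (forall a M', a \in s -> P M' -> P (body a M')) -> P M ->
  P (for_each s body M).
Proof.
rewrite /for_each; elim: s M => [//|a s IHs] M Pbody PM /=.
apply: IHs => [b M' sb|]; first by apply: Pbody; rewrite inE sb orbT.
by apply: Pbody; rewrite ?inE ?eqxx.
Qed.

(** Iteration [a] establishes [P] and no iteration destroys it; [I] is a background invariant on
    which both facts may rely. *)
Lemma for_each_reach (A : eqType) (I P : table -> Prop) (a : A) (s : seq A)
    (body : A -> table -> table) (M : table) :
  a \in s -> I M ->
  (forall b M', b \in s -> I M' -> I (body b M')) ->
  (forall M', I M' -> P (body a M')) ->
  (forall b M', b \in s -> I M' -> P M' -> P (body b M')) ->
  P (for_each s body M).
Proof.
rewrite /for_each; elim: s M => [//|b s IHs] M sa IM Ibody Pa Pbody /=.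
have sub c : c \in s -> c \in b :: s by rewrite inE => ->; rewrite orbT.
have Ib : I (body b M) by apply: Ibody; rewrite ?inE ?eqxx.
move: sa; rewrite inE => /predU1P[ab|sa]; last first.
  by apply: IHs => // [c M' /sub|c M' /sub]; [apply: Ibody | apply: Pbody].
have : I (body b M) /\ P (body b M) by split=> //; rewrite -ab; apply: Pa.
move=> IP; suff [] : I (for_each s body (body b M)) /\
  P (for_each s body (body b M)) by [].
apply: (for_each_inv (P := fun M' => I M' /\ P M')) => // c M' /sub sc [IM' PM'].
by split; [apply: Ibody | apply: Pbody].
Qed.

(** Here [P i] describes the table just before iteration [i]. *)
Lemma for_each_iota (P : nat -> table -> Prop) (a k : nat)
    (body : nat -> table -> table) (M : table) :
  P a M ->
  (forall i M', a <= i < a + k -> P i M' -> P i.+1 (body i M')) ->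
  P (a + k) (for_each (iota a k) body M).
Proof.
rewrite /for_each; elim: k a M => [|k IHk] a M PM Pbody /=.
  by rewrite addn0.
rewrite -addSnnS; apply: IHk => [|i M' /andP[ai ik]].
  by apply: Pbody => //; rewrite leqnn -[X in X < _]addn0 ltn_add2l.
by apply: Pbody; rewrite (ltnW ai) -addSnnS.
Qed.

(** Here [P i] describes the table once all iterations of index at least [i] have run. *)
Lemma for_each_rev_iota (P : nat -> table -> Prop) (a k : nat)
    (body : nat -> table -> table) (M : table) :
  P (a + k) M ->
  (forall i M', a <= i < a + k -> P i.+1 M' -> P i (body i M')) ->
  P a (for_each (rev (iota a k)) body M).
Proof.
rewrite /for_each; elim: k a M => [|k IHk] a M PM Pbody /=.
  by rewrite addn0 in PM.
rewrite rev_cons foldl_rcons; apply: (Pbody a).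
  by rewrite leqnn -[X in X < _]addn0 ltn_add2l.
apply: IHk => [|i M' /andP[ai ik]]; first by rewrite addSnnS.
by apply: Pbody; rewrite (ltnW ai) -addSnnS.
Qed.

(** Turns a loop over selected rows into one over a full interval, to which [for_each_rev_iota]
    applies. *)
Lemma for_each_filter (A : Type) (p : pred A) (s : seq A)
    (body : A -> table -> table) (M : table) :
  for_each [seq a <- s | p a] body M =
  for_each s (fun a M' => if p a then body a M' else M') M.
Proof.
by rewrite /for_each; elim: s M => [//|a s IHs] M /=; case: (p a) => /=.
Qed.

(** * Parse trees *)

Section ParseTree.

Variables (R : realType) (AP : finType) (V : eqType).
Implicit Types (phi psi : formula R AP V) (p : node) (x y : V).

Lemma root_in_nodes phi : [::] \in nodes phi.
Proof. by case: phi => *; rewrite inE. Qed.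

Lemma cons_in_map_cons (i j : nat) p (s : seq node) :
  (i :: p \in [seq j :: q | q <- s]) = (i == j) && (p \in s).
Proof.
case: eqP => [->|ij]; first by rewrite mem_map // => ? ? [].
by apply/mapP=> -[q _ [/ij]].
Qed.

Lemma cons_in_nodes phi i p :
  (i :: p \in nodes phi) =
  (i < size (children phi)) && (p \in nodes (nth Top (children phi) i)).
Proof.
by case: phi => [|a|x c r|f|f g|f g|f|f g|x f];
  rewrite /= inE //= ?mem_cat ?cons_in_map_cons //;
  case: i => [|[|i]] //=; rewrite orbF.
Qed.

(** [nodes] builds paths from the root, whereas [row_child] extends them at the far end; this lemma
    passes from one view to the other. *)
Lemma rcons_in_nodes phi p i :
  (rcons p i \in nodes phi) =
  (p \in nodes phi) && (i < size (children (subformula phi p))).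
Proof.
elim: p phi => [|j p IHp] phi /=.
  by rewrite cons_in_nodes !root_in_nodes andbT.
by rewrite !cons_in_nodes IHp /subformula /= andbA.
Qed.

(** Paths through different children differ in their first rank. Uniqueness makes [index] inverse to
    [nth] on the rows. *)
Lemma nodes_uniq phi : uniq (nodes phi).
Proof.
have inj (i : nat) : injective (cons i) by move=> ? ? [].
have notin i (s : seq node) : [::] \notin [seq i :: q | q <- s].
  by apply/mapP => -[].
have disj (s t : seq node) :
    ~~ has (in_mem^~ (mem [seq 0 :: q | q <- s])) [seq 1 :: q | q <- t].
  by apply/hasPn => _ /mapP[q _ ->]; rewrite /= cons_in_map_cons.
by elim: phi => [|a|x c r|f IHf|f IHf g IHg|f IHf g IHg|f IHf|f IHf g IHg|x f IHf];
  rewrite //= ?cat_uniq ?mem_cat ?negb_or ?notin ?disj /= ?map_inj_uniq ?IHf ?IHg.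
Qed.

Lemma subformula_rcons phi p i :
  subformula phi (rcons p i) = nth Top (children (subformula phi p)) i.
Proof. by rewrite /subformula foldl_rcons. Qed.

Lemma owner_from_rcons o phi p i :
  owner_from o phi (rcons p i) =
  if subformula phi p is Freeze x _ then Some x else owner_from o phi p.
Proof. by elim: p o phi => [|j p IHp] o phi //=; rewrite IHp. Qed.

Lemma frozen_vars_child phi i :
  {subset frozen_vars (nth Top (children phi) i) <= frozen_vars phi}.
Proof.
by move=> x; case: phi => [|a|y c r|f|f g|f g|f|f g|y f];
  case: i => [|[|i]] //=; rewrite ?nth_nil // ?mem_cat ?inE => ->; rewrite ?orbT.
Qed.

Lemma frozen_vars_subformula phi p :
  {subset frozen_vars (subformula phi p) <= frozen_vars phi}.
Proof.
elim/last_ind: p => [//|p i IHp] x; rewrite subformula_rcons.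
by move/frozen_vars_child; apply: IHp.
Qed.

Lemma free_vars_child phi i x :
  x \in free_vars (nth Top (children phi) i) ->
  x \in free_vars phi \/ exists psi, phi = Freeze x psi.
Proof.
case: phi => [|a|y c r|f|f g|f g|f|f g|y f];
  case: i => [|[|i]] //=; rewrite ?nth_nil // ?mem_cat ?mem_filter.
all: try by move=> ->; rewrite ?orbT; left.
by move=> xf; case: (eqVneq x y) => [<-|xy]; [right; exists f | left].
Qed.

(** Places every quantifier met in the subtree of [v] inside the body of some quantifier on [v], so
    that the innermost-first order applies to it. *)
Lemma owner_frozen phi p v :
  p \in nodes phi -> owner_from None phi p = Some v ->
  exists q psi, [/\ q \in nodes phi, subformula phi q = Freeze v psi
    & {subset frozen_vars (subformula phi p) <= frozen_vars psi}].
Proof.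
elim/last_ind: p => [//|p i IHp].
rewrite rcons_in_nodes owner_from_rcons subformula_rcons => /andP[pN].
case Dp: (subformula phi p) (IHp pN) =>
  [|a|x c r|f|f g|f g|f|f g|x f] IH //.
(* A parent that is not a freeze node passes its own owner on, so its witness serves again. *)
all: try by move=> _ /IH[q [psi [qN Dq sub]]]; exists q, psi; split=> // y;
  move/frozen_vars_child; apply: sub.
by rewrite ltnS leqn0 => /eqP-> [<-]; exists p, f; split.
Qed.

End ParseTree.

(** * Finite-trace semantics: dependence on the environment, unfolding of until *)

Section Semantics.

Variables (R : realType) (AP : finType) (V : eqType) (h : trace R AP).
Implicit Types (phi f g : formula R AP V) (e : env R V).

(** Applied to closed freeze formulas, this lets an entry computed for [env0] be read in any
    environment. *)
Lemma sat_agree phi i e1 e2 :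
  {in free_vars phi, e1 =1 e2} -> sat h i e1 phi <-> sat h i e2 phi.
Proof.
elim: phi i e1 e2 => [|a|x c r|f IHf|f IHf g IHg|f IHf g IHg|f IHf|f IHf g IHg|x f IHf]
  i e1 e2 /= E //.
- by rewrite E ?inE.
- by rewrite (IHf i e1 e2).
- by rewrite (IHf i e1 e2) ?(IHg i e1 e2) // => x Hx; apply: E; rewrite mem_cat Hx ?orbT.
- by rewrite (IHf i e1 e2) ?(IHg i e1 e2) // => x Hx; apply: E; rewrite mem_cat Hx ?orbT.
- by rewrite (IHf i.+1 e1 e2).
- have Ef k : sat h k e1 f <-> sat h k e2 f.
    by apply: IHf => x Hx; apply: E; rewrite mem_cat Hx.
  have Eg k : sat h k e1 g <-> sat h k e2 g.
    by apply: IHg => x Hx; apply: E; rewrite mem_cat Hx orbT.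
  by split=> -[j [ij /Eg gj fk]]; exists j; split=> // k /fk /Ef.
- apply: IHf => y Hy; rewrite /env_set; case: eqVneq => // yx.
  by apply: E; rewrite mem_filter yx.
Qed.

(** The recurrence behind the backward dynamic programming: the witness is either [i] itself or a
    later sample. *)
Lemma sat_until_unfold i e f g :
  i < size h ->
  sat h i e (Until f g) <->
  sat h i e g \/ (sat h i e f /\ sat h i.+1 e (Until f g)).
Proof.
move=> ih; split=> /= [[j [/andP[ij jh] gj fk]]|[gi|[fi [j [/andP[ij jh] gj fk]]]]].
- move: ij; rewrite leq_eqVlt => /predU1P[->|ij]; [by left | right].
  split; first by apply: fk; rewrite leqnn.
  exists j; split=> //; first by rewrite ij.
  by move=> k /andP[ik kj]; apply: fk; rewrite (ltnW ik).
- exists i; split=> //; first by rewrite leqnn.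
  by move=> k /andP[ik ki]; rewrite leqNgt ki in ik.
- exists j; split=> //; first by rewrite (ltnW ij).
  move=> k /andP[]; rewrite leq_eqVlt => /predU1P[<-//|ik kj].
  by apply: fk; rewrite ik.
Qed.

End Semantics.

(** * The table *)

(** These are the rows that [compute_ltl] reads back unchanged; [Top] is excluded because it is
    recomputed as a constant. *)
Definition is_leaf (R : realType) (AP : finType) (V : eqType)
    (phi : formula R AP V) : bool :=
  match phi with
  | Atom _ | Constr _ _ _ | Freeze _ _ => true
  | _ => false
  end.

Section Monitor.

Variables (R : realType) (AP : finType) (V : eqType).
Variables (phi : formula R AP V) (rows : seq node) (h : trace R AP).
Hypothesis hrows : topological phi rows.

Let is_row (j : nat) : bool := 0 < j <= size rows.
Let owner (j : nat) : option V := row_owner phi rows j.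
Let row (j : nat) : formula R AP V := row_formula phi rows j.

Lemma mem_rows : rows =i nodes phi.
Proof. by case: hrows => /perm_mem. Qed.

Lemma rows_uniq : uniq rows.
Proof. by case: hrows => /perm_uniq -> _; apply: nodes_uniq. Qed.

Lemma is_rowE j : is_row j = (j \in iota 1 (size rows)).
Proof. by rewrite mem_iota add1n ltnS. Qed.

Lemma row_node_in_nodes j : is_row j -> row_node rows j \in nodes phi.
Proof.
by case: j => // j /andP[_ jr]; rewrite -mem_rows /row_node mem_nth.
Qed.

Lemma index_row_node j : is_row j -> (index (row_node rows j) rows).+1 = j.
Proof.
by case: j => // j /andP[_ jr]; rewrite /row_node index_uniq ?rows_uniq.
Qed.

(** A nonempty path has a parent of strictly smaller index, so it cannot have index 0. *)
Lemma row1 : is_row 1 /\ row_node rows 1 = [::].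
Proof.
have r0 : [::] \in rows by rewrite mem_rows root_in_nodes.
have is1 : is_row 1 by rewrite /is_row; case: (rows) r0.
split=> //; case: hrows => _ top.
have := row_node_in_nodes is1; rewrite -mem_rows.
have := index_row_node is1.
by case/lastP: (row_node rows 1) => // p i [idx0] /top; rewrite idx0.
Qed.

Lemma row_childP j i (c := row_child rows j i) :
  is_row j -> i < size (children (row j)) ->
  [/\ is_row c, j < c, row c = nth Top (children (row j)) i
    & owner c = if row j is Freeze x _ then Some x else owner j].
Proof.
move=> rj ij; have idx := index_row_node rj.
have cr : rcons (row_node rows j) i \in rows.
  by rewrite mem_rows rcons_in_nodes row_node_in_nodes.
have Dc : row_node rows c = rcons (row_node rows j) i by apply: nth_index.
split; first by rewrite /is_row /= index_mem.
- by rewrite -{1}idx ltnS; case: hrows => _; apply.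
- by rewrite /row /row_formula Dc subformula_rcons.
- by rewrite /owner /row_owner Dc owner_from_rcons.
Qed.

Lemma compute_ltl_leaf j u M : is_leaf (row j) ->
  compute_ltl phi rows h j u M = M j u.
Proof. by rewrite /compute_ltl -/(row j); case: (row j). Qed.

(** The hypotheses follow the evaluation order: leaves are given, then rows of larger index at [u],
    then all rows at [u.+1]. The children of a row that is not a leaf have its owner and a larger
    index, hence are covered. *)
Lemma compute_ltl_correct (o : option V) (e : env R V) (j u : nat) (M : table) :
  is_row j -> owner j = o -> u < size h ->
  (is_leaf (row j) -> M j u <-> sat h u e (row j)) ->
  (forall k, is_row k -> owner k = o -> j < k ->
     M k u <-> sat h u e (row k)) ->
  (forall k, is_row k -> owner k = o -> u.+1 < size h ->
     M k u.+1 <-> sat h u.+1 e (row k)) ->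
  compute_ltl phi rows h j u M <-> sat h u e (row j).
Proof.
(* These facts mention [row j] and must be specialised by the case analysis on it; the last one is
   the entry at [u.+1] of the row itself, needed for until. *)
move=> rj oj uh leaf later next; move: (@row_childP j) leaf (next j rj oj).
have uh1 : (u.+1 == size h) = false -> u.+1 < size h.
  by move=> uh1; rewrite ltn_neqAle uh1.
rewrite /compute_ltl -/(row j) oj.
case: (row j) => [|a|x c r|f|f g|f g|f|f g|x f] child //=;
  try by move=> /(_ isT).
- move=> _ _; have [rc jc Dc oc] := child 0 rj isT.
  have := later _ rc oc jc; rewrite Dc /=.
  by case: (M _ _) => -[Mf fM]; split=> //; [move/(_ (Mf isT)) | move=> _ /fM].
- move=> _ _; have [rc jc Dc oc] := child 0 rj isT.
  have [rd jd Dd od] := child 1 rj isT.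
  rewrite -(rwP andP) (later _ rc oc jc) (later _ rd od jd) Dc Dd; tauto.
- move=> _ _; have [rc jc Dc oc] := child 0 rj isT.
  have [rd jd Dd od] := child 1 rj isT.
  rewrite -(rwP orP) (later _ rc oc jc) (later _ rd od jd) Dc Dd; tauto.
- move=> _ _; have [rc jc Dc oc] := child 0 rj isT.
  case: ifP => [/eqP ->|/uh1 uh2]; first by rewrite ltnn; split=> // -[].
  by rewrite (next _ rc oc uh2) Dc; split=> // -[].
move=> _ nextj; have [rc jc Dc oc] := child 0 rj isT.
have [rd jd Dd od] := child 1 rj isT.
apply: (iff_trans _ (iff_sym (sat_until_unfold e f g uh))).
(* At the last sample the second disjunct is impossible: a witness would have to be at least
   [size h]. *)
case: ifP => [/eqP uhE|/uh1 uh2].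
  rewrite (later _ rd od jd) Dd; split; [by left | case=> // -[_ [k [/andP[]]]]].
  by move=> uk; rewrite -uhE ltnNge uk.
rewrite -(rwP orP) -(rwP andP) (later _ rc oc jc) (later _ rd od jd) Dc Dd.
have -> : M j u.+1 <-> sat h u.+1 e (Until f g) by exact: nextj.
by [].
Qed.

(** Such a row may be written to, but only with the value it already holds. *)
Lemma evaluate_ltl_leaf o t M j u : is_leaf (row j) ->
  evaluate_ltl phi rows h o t M j u = M j u.
Proof.
move=> lj; apply: (for_each_inv (P := fun M' => M' j u = M j u)) => // v M1 _ E.
apply: (for_each_inv (P := fun M' => M' j u = M j u)) => // k M2 _ E2.
rewrite /set_entry; case: andP => // -[/eqP jk /eqP uv].
by rewrite -jk -uv compute_ltl_leaf.
Qed.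

Lemma evaluate_ltl_correct o (e : env R V) t (M : table) :
  t <= size h ->
  (forall j u, is_row j -> owner j = o -> is_leaf (row j) ->
     t <= u < size h -> M j u <-> sat h u e (row j)) ->
  forall j u, is_row j -> owner j = o -> t <= u < size h ->
    evaluate_ltl phi rows h o t M j u <-> sat h u e (row j).
Proof.
move=> th leaf.
pose ok (M' : table) j u := M' j u <-> sat h u e (row j).
pose leaves (M' : table) := forall j u, is_row j -> owner j = o ->
  is_leaf (row j) -> t <= u < size h -> ok M' j u.
(* Samples from [i] on are done; [leaves] is carried along for the samples still to come. *)
pose outer i (M' : table) := leaves M' /\
  forall j u, is_row j -> owner j = o -> i <= u < size h -> ok M' j u.
suff [_ ?] : outer t (evaluate_ltl phi rows h o t M) by [].
apply: for_each_rev_iota.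
  rewrite subnKC //; split=> // j u _ _ /andP[hu uh].
  by rewrite ltnNge hu in uh.
rewrite subnKC // => u {leaf}M /andP[tu uh] [Ml Mu]; rewrite for_each_filter.
(* Within sample [u], rows from [i] on are done as well. *)
pose inner i (M' : table) := outer u.+1 M' /\
  forall j, is_row j -> owner j = o -> i <= j -> ok M' j u.
suff [[Ml' Mu'] Mu''] : inner 1 (for_each (rev (iota 1 (size rows)))
    (fun j M' => if row_owner phi rows j == o
       then set_entry M' j u (compute_ltl phi rows h j u M') else M') M).
  split=> // j v rj oj /andP[]; rewrite leq_eqVlt => /predU1P[<- _|uv vh].
    by apply: Mu'' => //; case/andP: rj.
  by apply: Mu' => //; rewrite uv.
apply: for_each_rev_iota.
  split=> // j /andP[_ jr] _; rewrite add1n => rj.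
  by rewrite ltnNge jr in rj.
move=> j {Ml Mu}M; rewrite add1n ltnS => rj [[Ml Mu] Mj].
case: eqP => oj; last first.
  split=> // k rk ok'; rewrite leq_eqVlt => /predU1P[jk|]; last exact: Mj.
  by rewrite jk in oj.
have new : compute_ltl phi rows h j u M <-> sat h u e (row j).
  apply: (compute_ltl_correct (o := o)) => //.
    by move=> lj; apply: Ml => //; rewrite tu.
  by move=> k rk ok' uh'; apply: Mu => //; rewrite leqnn.
(* The value written is itself correct, so the write spoils no correct entry; all three parts of the
   invariant follow from this. *)
have upd k v : ok M k v \/ (k = j /\ v = u) ->
    ok (set_entry M j u (compute_ltl phi rows h j u M)) k v.
  rewrite /ok /set_entry; case: andP => [[/eqP-> /eqP-> _]|ne]; first exact: new.
  by case=> // -[kj vu]; case: ne; rewrite kj vu !eqxx.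
split; first split.
- by move=> k v rk ok' lk tv; apply: upd; left; apply: Ml.
- by move=> k v rk ok' uv; apply: upd; left; apply: Mu.
- move=> k rk ok'; rewrite leq_eqVlt => /predU1P[<-|jk]; apply: upd.
    by right.
  by left; apply: Mj.
Qed.

(** Every write to this entry stores the same value, so it suffices that one iteration reaches
    it. *)
Lemma set_atoms_correct M j u a :
  is_row j -> u < size h -> row j = Atom a ->
  set_atoms phi rows h M j u = (a \in state_at h u).
Proof.
move=> rj uh Dj.
pose P (M' : table) := M' j u = (a \in state_at h u).
have keep i v M' : P M' -> P (if row i is Atom b
    then set_entry M' i v (b \in state_at h v) else M').
  rewrite /P => PM; case Di: (row i) => [|b|||||||] //.
  rewrite /set_entry; case: andP => // -[/eqP ji /eqP uv].
  by move: Di; rewrite -ji -uv Dj => -[->].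
apply: (for_each_reach (I := fun=> True) (P := P) (a := j)) => //.
- by rewrite -is_rowE.
- move=> M' _.
  apply: (for_each_reach (I := fun=> True) (P := P) (a := u)) => //.
  + by rewrite mem_iota.
  + by move=> M2 _; rewrite -/(row j) Dj /P /set_entry !eqxx.
  + by move=> v M2 _ _; apply: keep.
- by move=> i M' _ _ PM; apply: for_each_inv => // v M2 _; apply: keep.
Qed.

Lemma set_constraints_other v t M j u :
  (forall c r, row j <> Constr v c r) ->
  set_constraints phi rows h v t M j u = M j u.
Proof.
move=> Dj.
apply: (for_each_inv (P := fun M' => M' j u = M j u)) => // k M1 _ E1.
apply: (for_each_inv (P := fun M' => M' j u = M j u)) => // w M2 _ E2.
rewrite -/(row k); case Dk: (row k) => [||x c r||||||] //.
case: eqP Dk => // -> Dk; rewrite /set_entry; case: andP => // -[/eqP jk _].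
by case: (Dj c r); rewrite jk.
Qed.

Lemma set_constraints_correct v t M j u c r :
  is_row j -> t <= u < size h -> row j = Constr v c r ->
  set_constraints phi rows h v t M j u =
  cmpb c (time_at h u - time_at h t)%R r%:num%R.
Proof.
move=> rj tu Dj.
pose P (M' : table) := M' j u = cmpb c (time_at h u - time_at h t)%R r%:num%R.
have keep i w M' : P M' -> P (if row i is Constr x c' r' then
    if x == v then
      set_entry M' i w (cmpb c' (time_at h w - time_at h t)%R r'%:num%R)
    else M' else M').
  rewrite /P => PM; case Di: (row i) => [||x c' r'||||||] //.
  case: eqP => // _.
  rewrite /set_entry; case: andP => // -[/eqP ji /eqP uv].
  by move: Di; rewrite -ji -uv Dj => -[_ -> ->].
apply: (for_each_reach (I := fun=> True) (P := P) (a := j)) => //.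
- by rewrite -is_rowE.
- move=> M' _.
  apply: (for_each_reach (I := fun=> True) (P := P) (a := u)) => //.
  + by rewrite mem_iota subnKC //; case/andP: tu => [tu uh]; apply: ltnW; apply: leq_ltn_trans uh.
  + by move=> M2 _; rewrite -/(row j) Dj /P eqxx /set_entry !eqxx.
  + by move=> w M2 _ _; apply: keep.
- by move=> i M' _ _ PM; apply: for_each_inv => // w M2 _; apply: keep.
Qed.

Lemma copy_root_other v t M j u :
  (forall psi, row j = Freeze v psi -> u <> t) ->
  copy_root phi rows v t M j u = M j u.
Proof.
move=> Dj.
apply: (for_each_inv (P := fun M' => M' j u = M j u)) => // k M1 _ E1.
rewrite -/(row k); case Dk: (row k) => [||||||||x f] //.
case: eqP Dk => // -> Dk; rewrite /set_entry.
case: andP => // -[/eqP jk /eqP ut].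
by case: (Dj f); rewrite ?jk.
Qed.

(** The loop reads the table while changing it. Since [v] is not frozen in [psi], the root of the
    subtree is not a freeze row of [v], and the entry being read is never overwritten. *)
Lemma copy_root_correct v t M j psi :
  is_row j -> row j = Freeze v psi -> v \notin frozen_vars psi ->
  copy_root phi rows v t M j t = M (row_child rows j 0) t.
Proof.
move=> rj Dj vpsi; set c := row_child rows j 0.
have Dc : row c = psi.
  by have := @row_childP j 0 rj; rewrite Dj => /(_ isT)[].
pose I (M' : table) := M' c t = M c t.
have Ibody k M' : I M' -> I (if row k is Freeze x _ then
    if x == v then set_entry M' k t (M' (row_child rows k 0) t) else M'
    else M').
  rewrite /I => IM; case Dk: (row k) => [||||||||x f] //.
  case: eqP Dk => // -> Dk; rewrite /set_entry.
  case: andP => // -[/eqP ck _].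
  by move: vpsi; rewrite -Dc ck Dk inE eqxx.
apply: (for_each_reach (I := I) (P := fun M' => M' j t = M c t) (a := j)) => //.
- by rewrite -is_rowE.
- by move=> k M' _; apply: Ibody.
- by move=> M' IM; rewrite -/(row j) Dj eqxx /set_entry !eqxx.
- move=> k M' _ IM PM; rewrite -/(row k).
  case Dk: (row k) => [||||||||x f] //; case: eqP => // _.
  by rewrite /set_entry; case: andP => // -[/eqP <- _].
Qed.

(** * Encapsulated formulas *)

Hypothesis hphi : encapsulated phi.

Lemma freeze_independent p x psi :
  p \in nodes phi -> subformula phi p = Freeze x psi ->
  x \in frozen_vars phi /\ independent phi x.
Proof.
move=> pN Dp; have xphi : x \in frozen_vars phi.
  by have := @frozen_vars_subformula _ _ _ phi p x; rewrite Dp inE eqxx; apply.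
by split=> //; apply: hphi; rewrite mem_undup mem_cat xphi orbT.
Qed.

(** By independence [x] is the only variable that may be free in the body, and the quantifier binds
    it. *)
Lemma freeze_closed p x psi :
  p \in nodes phi -> subformula phi p = Freeze x psi ->
  free_vars (Freeze x psi) = [::].
Proof.
move=> pN Dp; have [_ [_ _ /(_ p psi pN Dp) only_x]] := freeze_independent pN Dp.
apply/eqP; rewrite -size_eq0 -leqn0 leqNgt -has_predT; apply/hasPn => y.
by rewrite mem_filter => /andP[yx /only_x /eqP]; rewrite (negbTE yx).
Qed.

(** Climbing from [p], the variable stays free until a quantifier on [x] is met: a quantifier on
    another variable is closed and would stop it, and it cannot be free at the root. *)
Lemma free_var_owner p x :
  p \in nodes phi -> x \in free_vars (subformula phi p) ->
  owner_from None phi p = Some x.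
Proof.
elim/last_ind: p => [_ xphi|p i IHp].
  have [|_] := hphi (x := x); last by rewrite xphi.
  by rewrite mem_undup mem_cat xphi.
rewrite rcons_in_nodes subformula_rcons owner_from_rcons => /andP[pN _].
case/free_vars_child => [xp|[psi ->] //].
move: (xp); case Dp: (subformula phi p) => [||||||||y f]; try by rewrite IHp.
by rewrite (freeze_closed pN Dp).
Qed.

Variable vs : seq V.
Hypothesis hvs : innermost_first phi vs.

(* D is the set of variables already treated: the rows that the later passes
   read without recomputing them are correct. *)
Let settled (D : seq V) (M : table) : Prop :=
  (forall j u a, is_row j -> u < size h -> row j = Atom a ->
     M j u = (a \in state_at h u)) /\
  (forall j u x psi, is_row j -> u < size h -> row j = Freeze x psi ->
     x \in D -> M j u <-> sat h u env0 (row j)).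

(** Constraint rows are left to the caller, only for the owner variable: [free_var_owner] rules out
    all others. Freeze rows move from [env0] to [e] because they are closed. *)
Lemma settled_leaf D (M : table) o e j u :
  settled D M -> is_row j -> owner j = o -> is_leaf (row j) -> u < size h ->
  (forall x psi, row j = Freeze x psi -> x \in D) ->
  (forall x c r, o = Some x -> row j = Constr x c r ->
     M j u <-> sat h u e (row j)) ->
  M j u <-> sat h u e (row j).
Proof.
move=> [Ma Mf] rj oj lj uh jD jC; have jN := row_node_in_nodes rj.
case Dj: (row j) lj => [|a|x c r||||||x f] // _.
- by rewrite (Ma _ _ _ rj uh Dj).
- rewrite -Dj; apply: (jC _ _ _ _ Dj); rewrite -oj; apply: free_var_owner => //.
  by rewrite -[subformula _ _]/(row j) Dj inE.
- rewrite (Mf _ _ _ _ rj uh Dj (jD _ _ Dj)) Dj; apply: sat_agree.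
  by rewrite (freeze_closed jN Dj).
Qed.

Let pass (v : V) (t : nat) (M : table) : table :=
  copy_root phi rows v t
    (evaluate_ltl phi rows h (Some v) t
      (set_constraints phi rows h v t M)).

(** Describes the entries that survive a pass, so that earlier results can be carried to later
    ones. *)
Lemma pass_other v t M j u :
  is_leaf (row j) -> (forall c r, row j <> Constr v c r) ->
  (forall psi, row j = Freeze v psi -> u <> t) ->
  pass v t M j u = M j u.
Proof.
move=> lj jC jF.
by rewrite /pass copy_root_other // evaluate_ltl_leaf // set_constraints_other.
Qed.

Lemma pass_correct D v t M j psi :
  settled D M ->
  (forall p f, p \in nodes phi -> subformula phi p = Freeze v f ->
     {subset frozen_vars f <= D}) ->
  t < size h -> is_row j -> row j = Freeze v psi ->
  pass v t M j t <-> sat h t env0 (row j).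
Proof.
move=> MD inner th rj Dj; have jN := row_node_in_nodes rj.
(* Otherwise [v] would strictly precede itself in [vs]. *)
have vpsi : v \notin frozen_vars psi.
  by case: hvs => _ lt_vs; apply/negP => /(lt_vs _ _ _ _ jN Dj); rewrite ltnn.
rewrite /pass (copy_root_correct _ _ rj Dj vpsi).
have := @row_childP j 0 rj; rewrite Dj => /(_ isT)[rc _ Dc oc] /=.
(* The environment of the pass comes from the semantics of the quantifier: [env0] updated at [v]
   with the time of sample [t]. *)
rewrite -[psi]Dc; apply: evaluate_ltl_correct => //; last by rewrite leqnn.
  exact: ltnW.
move=> k u rk ok lk /andP[tu uh].
apply: (settled_leaf (D := D) (o := Some v)) => //.
- case: MD => Ma Mf; split=> [i w a ri wh Di|i w x f ri wh Di xD].
    rewrite set_constraints_other ?(Ma _ _ _ ri wh Di) // => c r.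
    by rewrite Di.
  rewrite set_constraints_other ?(Mf _ _ _ _ ri wh Di xD) // => c r.
  by rewrite Di.
- move=> x f Dk.
  have [q [g [qN Dq sub]]] := owner_frozen (row_node_in_nodes rk) ok.
  apply: (inner _ _ qN Dq); apply: sub.
  by rewrite -[subformula _ _]/(row k) Dk inE eqxx.
(* In that environment the constraint compares exactly the stored difference of times. *)
- move=> x c r [<-] Dk; rewrite (set_constraints_correct _ rk _ Dk) ?tu //.
  by rewrite Dk /= /env_set eqxx.
Qed.

Lemma passes_settled M : settled [::] M ->
  settled vs (for_each vs (fun v => for_each (iota 0 (size h)) (pass v)) M).
Proof.
case: hvs => pvs lt_vs; have uvs : uniq vs by rewrite (perm_uniq pvs) undup_uniq.
(* Generalised to any split of [vs] into treated and remaining variables. *)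
suff step todo D M' : vs = D ++ todo -> settled D M' ->
    settled vs (for_each todo (fun v => for_each (iota 0 (size h)) (pass v)) M').
  exact: step.
rewrite /for_each; elim: todo D M' => [|v todo IH] D M' Dvs MD /=.
  by rewrite Dvs cats0.
apply: (IH (rcons D v)); first by rewrite cat_rcons.
have vD : v \notin D.
  by move: uvs; rewrite Dvs cat_uniq /= negb_or => /and3P[_ /andP[]].
have inner p f : p \in nodes phi -> subformula phi p = Freeze v f ->
    {subset frozen_vars f <= D}.
  move=> pN Dp y /(lt_vs _ _ _ _ pN Dp).
  (* As [v] is not in [D], its index is [size D]; a variable of smaller index therefore lies in
     [D]. *)
  rewrite Dvs !index_cat (negbTE vD) /= eqxx addn0.
  by case: ifP => // _; rewrite ltnNge leq_addr.
(* While [v] is being treated, its freeze rows are correct at the samples before [t]. *)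
pose P t (M1 : table) := settled D M1 /\
  forall j u psi, is_row j -> u < t -> u < size h -> row j = Freeze v psi ->
    M1 j u <-> sat h u env0 (row j).
suff [[Ma Mf] Mv] : P (0 + size h) (for_each (iota 0 (size h)) (pass v) M').
  split=> // j u x psi rj uh Dj; rewrite mem_rcons inE => /predU1P[xv|]; last first.
    exact: Mf Dj.
  by apply: (Mv j u psi); rewrite // Dj xv.
apply: for_each_iota => // t M1 /andP[_ th] [M1D M1v]; split.
  case: (M1D) => Ma Mf; split=> [j u a rj uh Dj|j u x psi rj uh Dj xD].
    by rewrite pass_other ?Dj //; apply: Ma Dj.
  (* A settled freeze row cannot belong to [v], which is outside [D], so the pass leaves it
     alone. *)
  rewrite pass_other ?(Mf _ _ _ _ rj uh Dj xD) ?Dj // => f [xv].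
  by move: vD; rewrite -xv xD.
move=> j u psi rj; rewrite ltnS leq_eqVlt => /predU1P[->|ut] uh Dj.
  exact: pass_correct M1D inner th rj Dj.
rewrite pass_other ?(M1v _ _ _ rj ut uh Dj) ?Dj // => f _ utE.
by rewrite utE ltnn in ut.
Qed.

Lemma tptl_monitor_correct M0 : 0 < size h ->
  tptl_monitor phi rows vs h M0 <-> sat h 0 env0 phi.
Proof.
move=> h0; have [r1 D1] := row1.
have row1E : row 1 = phi by rewrite /row /row_formula D1.
have atoms_settled : settled [::] (set_atoms phi rows h M0).
  by split=> // j u a rj uh Dj; apply: set_atoms_correct.
have MD := passes_settled atoms_settled.
rewrite -[X in sat _ _ _ X]row1E; apply: evaluate_ltl_correct => //.
  move=> j u rj oj lj /andP[_ uh]; apply: (settled_leaf MD rj oj lj uh) => //.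
  (* With owner [None] no constraint row remains, and every freeze row is settled because [vs] lists
     all time variables. *)
  move=> x f Dj; case: hvs => pvs _.
  have [xphi _] := freeze_independent (row_node_in_nodes rj) Dj.
  by rewrite (perm_mem pvs) mem_undup mem_cat xphi orbT.
by rewrite /owner /row_owner D1.
Qed.

End Monitor.

Theorem mainTheorem1 (R : realType) (AP : finType) (V : eqType)
  (phi : formula R AP V) (hphi : encapsulated phi)
  (rho : tss R AP) (n : nat) (hn : is_true (0 < n)%N)
  (rows : seq node) (hrows : topological phi rows)
  (vs : seq V) (hvs : innermost_first phi vs)
  (M0 : table) :
  tptl_monitor phi rows vs (prefix_of rho n) M0 = true <->
  sat (prefix_of rho n) 0 env0 phi.
Proof. by apply: tptl_monitor_correct; rewrite // size_mkseq. Qed.
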